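(* Let $(f,k,\alpha) \in \mathcal{B}(\Delta_\xi, r)$ and $\pi \in S_{D+1}$. Then $$A_{\pi^{-1}}^*\big(w(\xi; f,k,\alpha)\big) = b(\lambda; \pi(\alpha))\, A_{\pi^{-1}}^*\big(\psi(\xi; f,k,\mathbf{1}_\alpha)\big),$$ and exactly one of the following holds. 1. (Relabelled.) If $\alpha_k = 0$ or $\pi(k) \neq \min \pi(f)$, then $$A_{\pi^{-1}}^*\big(w(\xi; f,k,\alpha)\big) = w(\lambda; \pi(f), \pi(k), \pi(\alpha)),$$ with $(\pi(f),\pi(k),\pi(\alpha)) \in \mathcal{B}(\Delta_\lambda, r)$. 2. (Filter hit.) If $\alpha_k > 0$ and $\pi(k) = \min \pi(f)$, then $$A_{\pi^{-1}}^*\big(w(\xi; f,k,\alpha)\big) = -\sum_{v \in \pi(f)\setminus \pi(k)} w(\lambda; \pi(f), v, \pi(\alpha)),$$ with $(\pi(f), v, \pi(\alpha)) \in \mathcal{B}(\Delta_\lambda, r)$ for all $v$ of the sum.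
   Context: $D \ge 1$ and $r \ge 1$ are integers and $\Delta = [v_0,\dots,v_D] \subset \mathbb{R}^D$ is a non-degenerate $D$-simplex with vertex labels $0,\dots,D$, naturally ordered. Its barycentric coordinates $\xi = (\xi_0,\dots,\xi_D)$ are the affine functions with $\xi_i(v_j) = \delta_{ij}$; they satisfy $\sum_i \xi_i = 1$, hence $\sum_i \mathrm{d}\xi_i = 0$. A face is identified with its label set $f \subseteq \{0,\dots,D\}$; $\dim f = |f|-1$, $\min f$ is the smallest label, $f \setminus k$ means $f \setminus \{k\}$. A multi-exponent is $\alpha \in \mathbb{N}_0^{D+1}$ with $|\alpha| = \sum_i \alpha_i$, $\operatorname{supp}(\alpha) = \{i : \alpha_i > 0\}$, and support indicator $\mathbf{1}_\alpha \in \{0,1\}^{D+1}$, $(\mathbf{1}_\alpha)_i = 1$ iff $\alpha_i > 0$. Write $b(\xi;\alpha) = \xi^\alpha = \prod_i \xi_i^{\alpha_i}$. Directional forms: for a face $f$ with $\dim f \ge 1$, $k \in f$ and $s \in \{0,1\}^{D+1}$ with $\operatorname{supp}(s) \cup \{k\} = f$, $\psi(\xi; f,k,s) = \mathrm{d}\xi_k - \frac{s_k}{|s|}\sum_{j\in f} \mathrm{d}\xi_j$. It is called anchored if $s_i = 0$ for all $i < \min(f \setminus k)$. $\mathcal{S}(\Delta_\xi, r)$ is the set of triplets $(f,k,\alpha)$ with $\dim f \ge 1$, $k \in f$, $|\alpha| = r$, $\operatorname{supp}(\alpha) \cup \{k\} = f$; to each is associated the 1-form $w(\xi; f,k,\alpha)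 = b(\xi;\alpha)\,\psi(\xi; f,k,\mathbf{1}_\alpha)$. $\mathcal{B}(\Delta_\xi, r)$ is the subset of triplets of $\mathcal{S}(\Delta_\xi, r)$ for which $\psi(\xi; f,k,\mathbf{1}_\alpha)$ is anchored. Relabelling: $S_{D+1}$ is the group of bijections of $\{0,\dots,D\}$. $\Delta_\xi$ and $\Delta_\lambda$ are two copies of $\Delta$ whose barycentric coordinates are denoted $\xi$ and $\lambda$; all definitions above are also used on $\Delta_\lambda$ with $\lambda$ in place of $\xi$ (the sets of triplets are the same). $A_\pi : \Delta_\xi \to \Delta_\lambda$ is the affine map with $A_\pi(v_i) = v_{\pi(i)}$; $A_{\pi^{-1}} = A_\pi^{-1} : \Delta_\lambda \to \Delta_\xi$, and the pullback $A_{\pi^{-1}}^*$ takes forms on $\Delta_\xi$ to forms on $\Delta_\lambda$; it is the substitution $\xi_i \mapsto \lambda_{\pi(i)}$, $\mathrm{d}\xi_i \mapsto \mathrm{d}\lambda_{\pi(i)}$. On label sets, $\pi(f) = \{\pi(i) : i\in f\}$; on vectors indexed by labels, $\pi(\alpha)_i = \alpha_{\pi^{-1}(i)}$. *)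

(* Defs.v *)
From HB Require Import structures.
From mathcomp Require Import all_boot all_order all_fingroup all_algebra.
From mathcomp Require Import all_classical all_reals all_analysis.

Set Implicit Arguments.
Unset Strict Implicit.
Unset Printing Implicit Defensive.
Import Order.TTheory GRing.Theory Num.Theory.
Import numFieldNormedType.Exports.

Local Open Scope classical_set_scope.
Local Open Scope ring_scope.

Section Simplex.
Variables (R : realType) (D : nat).
Implicit Type v : 'I_D.+1 -> 'rV[R]_D.

Definition affine_map (V W : lmodType R) (g : V -> W) : Prop :=
  linear (fun x => g x - g 0).

Definition nondegenerate_simplex v : Prop :=
  free [tuple v (lift ord0 i) - v ord0 | i < D].

Definition simplex v : set 'rV[R]_D :=
  [set x | exists t : 'I_D.+1 -> R,
    [/\ forall i, 0 <= t i, \sum_i t i = 1 & x = \sum_i t i *: v i]].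

(* When [v] is non-degenerate this determines [xi] uniquely. *)
Definition barycentric v (xi : 'I_D.+1 -> 'rV[R]_D -> R^o) : Prop :=
  forall i, affine_map (xi i) /\ forall j, xi i (v j) = (i == j)%:R.

Definition relabelling_map v (p : 'S_D.+1) (A : 'rV[R]_D -> 'rV[R]_D) : Prop :=
  affine_map A /\ forall i, A (v i) = v (p i).

End Simplex.

Section Labels.
Variable D : nat.
Implicit Types (f : {set 'I_D.+1}) (k : 'I_D.+1).
Implicit Types (a : {ffun 'I_D.+1 -> nat}) (s : {ffun 'I_D.+1 -> bool}).

Definition face_dim f : nat := #|f|.-1.

(* Only meaningful for nonempty [f]. *)
Definition face_min f : 'I_D.+1 := \big[Order.min/ord_max]_(i in f) i.

Definition supp a : {set 'I_D.+1} := [set i | (0 < a i)%N].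

Definition support_ind a : {ffun 'I_D.+1 -> bool} := [ffun i => (0 < a i)%N].

Definition anchored f k s : Prop :=
  forall i : 'I_D.+1, (i < face_min (f :\ k))%N -> s i = false.

Definition triplet : Type :=
  ({set 'I_D.+1} * 'I_D.+1 * {ffun 'I_D.+1 -> nat})%type.

Definition calS (r : nat) : set triplet :=
  [set t : triplet | let: (f, k, a) := t in
    [/\ (1 <= face_dim f)%N, k \in f, (\sum_(i < D.+1) a i)%N = r
      & supp a :|: [set k]%SET = f]].

Definition calB (r : nat) : set triplet :=
  [set t : triplet | calS r t /\
    let: (f, k, a) := t in anchored f k (support_ind a)].

(* (p . a)_i = a_(p^-1 i), so that (p . a)_(p i) = a_i. *)
Definition relabel_exp (p : 'S_D.+1) a : {ffun 'I_D.+1 -> nat} :=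
  [ffun i => a ((p^-1)%g i)].

End Labels.

Section Forms.
Variables (R : realType) (D : nat).

(* A form is given on the whole space, so that ['d] also makes sense at the
   boundary points of the simplex; forms are to be compared on [simplex v]. *)
Definition form1 : Type := 'rV[R]_D -> 'Hom('rV[R]_D, R^o).

Definition dform (g : 'rV[R]_D -> R^o) : form1 := fun x => linfun ('d g x).

Definition pullback (A : 'rV[R]_D -> 'rV[R]_D) (om : form1) : form1 :=
  fun x => (om (A x) \o linfun ('d A x))%VF.

Implicit Types (xi : 'I_D.+1 -> 'rV[R]_D -> R^o).
Implicit Types (f : {set 'I_D.+1}) (k : 'I_D.+1).
Implicit Types (a : {ffun 'I_D.+1 -> nat}) (s : {ffun 'I_D.+1 -> bool}).

Definition bmono xi a (x : 'rV[R]_D) : R := \prod_i xi i x ^+ a i.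

(* Intended for [supp s :|: [set k] = f]; the coefficient involves a division
   by zero only when [s] vanishes identically. *)
Definition psi xi f k s : form1 := fun x =>
  dform (xi k) x
  - ((s k)%:R / (\sum_i s i)%N%:R) *: \sum_(j in f) dform (xi j) x.

Definition wform xi f k a : form1 := fun x =>
  bmono xi a x *: psi xi f k (support_ind a) x.

End Forms.

(* Main.v *)
Require Import Defs.
From HB Require Import structures.
From mathcomp Require Import all_boot all_order all_fingroup all_algebra.
From mathcomp Require Import all_classical all_reals all_analysis.

Set Implicit Arguments.
Unset Strict Implicit.
Unset Printing Implicit Defensive.
Import Order.TTheory GRing.Theory Num.Theory.
Import numFieldNormedType.Exports.

Local Open Scope classical_set_scope.
Local Open Scope ring_scope.

(** Affine maps agreeing at the vertices of a non-degenerate simplex are equal, so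
    [xi i \o A q = lam (p i)], and by the chain rule the pullback is the
    substitution of [lam (p i)] for [xi i].  A relabelled triplet stays anchored
    unless the relabelled [k] is the smallest label of its face and lies in the
    support.  In that case the support is the whole face [f], and the forms
    [psi f u s], [u \in f], sum to zero, which expresses the offending form
    through the other, anchored ones. *)

(** * Affine maps and their linear parts *)

Lemma affine_map_linear_part (R : realType) (V W : lmodType R) (g : V -> W) :
  affine_map g -> exists2 L : {linear V -> W}, L =1 (fun x => g x - g 0) &
  g = (fun x => L x + g 0).
Proof.
move=> gA; pose L : {linear V -> W} := HB.pack (fun x => g x - g 0)
  (@GRing.isLinear.Build R V W *:%R (fun x => g x - g 0) gA).
by exists L => //; apply/funext => x; rewrite /= subrK.
Qed.

Lemma affine_map_comp (R : realType) (U V W : lmodType R)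
    (g : V -> W) (h : U -> V) :
  affine_map g -> affine_map h -> affine_map (g \o h).
Proof.
move=> /affine_map_linear_part[G GE gE] /affine_map_linear_part[H HE _] c x y /=.
have E z : g (h z) - g (h 0) = G (H z).
  by rewrite HE linearB !GE opprB addrA subrK.
by rewrite !E !linearP.
Qed.

Section RowVectors.
Variables (R : realType) (n : nat).

(** Expansion in the standard basis reduces this to continuity of the coordinates; it supplies the
    differentiability of affine maps that the chain rule needs. *)
Lemma linear_rV_continuous (W : normedModType R) (L : {linear 'rV[R]_n -> W}) :
  continuous L.
Proof.
have -> : (L : _ -> _) = fun x => \sum_i x ord0 i *: L (delta_mx 0 i).
  apply/funext => x; rewrite {1}[x]row_sum_delta linear_sum.
  by apply: eq_bigr => i _; rewrite linearZ.
apply: (@continuous_big W _ +%R 0 xpredT) => [|i _ x].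
  exact: add_continuous.
by have xi_cvg := @coord_continuous R 1 n ord0 i x; exact: (cvgZr_tmp xi_cvg).
Qed.

Lemma affine_map_differentiable (W : normedModType R) (g : 'rV[R]_n -> W) x :
  affine_map g -> differentiable g x.
Proof.
move=> /affine_map_linear_part[L _ ->].
rewrite -[fun _ => _]/((L : _ -> _) + cst (g 0)).
apply: differentiableD; last exact: differentiable_cst.
exact/linear_differentiable/linear_rV_continuous.
Qed.

(** The [n] edge vectors issuing from [v ord0] are free in dimension [n], hence span, so the linear
    parts agree; the common value at [v ord0] then fixes the constants. *)
Lemma affine_map_eq_simplex (v : 'I_n.+1 -> 'rV[R]_n) (W : vectType R)
    (g h : 'rV[R]_n -> W) :
  nondegenerate_simplex v -> affine_map g -> affine_map h ->
  (forall i, g (v i) = h (v i)) -> g = h.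
Proof.
move=> vF /affine_map_linear_part[G GE gE] /affine_map_linear_part[H HE hE] gh.
have fullE : <<[tuple v (lift ord0 i) - v ord0 | i < n]>>%VS = fullv.
  apply/eqP; rewrite -dimv_leqif_eq ?subvf // dimvf /dim /= mul1n.
  by move/eqP: vF => ->; rewrite size_tuple.
have /lfunP GH : linfun G = linfun H.
  apply/(fullv_lfunP _ _ fullE) => _ /mapP[i _ ->].
  rewrite !lfunE !linearB !GE !HE !gh.
  by rewrite !opprB !addrA !subrK.
have {}GH x : G x = H x by have := GH x; rewrite !lfunE.
have g0h0 : g 0 = h 0.
  by have := GH (v ord0); rewrite GE HE gh => /addrI/oppr_inj.
by apply/funext => x; rewrite gE hE /= GH g0h0.
Qed.

End RowVectors.

(** * Combinatorics of labels: smallest labels, relabelled exponents, anchoring *)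

Section FaceMin.
Variable D : nat.
Implicit Types (f : {set 'I_D.+1}) (i : 'I_D.+1).

Lemma face_min_le f i : i \in f -> (face_min f <= i)%N.
Proof.
move=> fi; suff : (face_min f <= i)%O by rewrite leEord.
exact: bigmin_inf fi _.
Qed.

Lemma face_min_mem f i : i \in f -> face_min f \in f.
Proof.
move=> fi.
(* The default [ord_max] bounds every label, so over a nonempty face the minimum is attained at a
   member. *)
by have [|j fj e] := @eq_bigmin _ _ _ ord_max i (mem f) id fi;
  [move=> j _; rewrite leEord -ltnS | rewrite /face_min e].
Qed.

End FaceMin.

Section Exponents.
Variables (D : nat) (p : 'S_D.+1) (a : {ffun 'I_D.+1 -> nat}).
Implicit Types (f : {set 'I_D.+1}) (k : 'I_D.+1).

Lemma relabel_expE k : relabel_exp p a (p k) = a k.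
Proof. by rewrite ffunE permK. Qed.

Lemma supp_relabel : supp (relabel_exp p a) = p @: supp a.
Proof.
apply/setP => i; rewrite -[i](permKV p) mem_imset; last exact: perm_inj.
by rewrite !inE relabel_expE.
Qed.

Lemma calS_relabel r f k :
  calS r (f, k, a) -> calS r (p @: f, p k, relabel_exp p a).
Proof.
move=> [fD kf ar sf]; split.
- by rewrite /face_dim card_imset //; exact: perm_inj.
- by rewrite mem_imset //; exact: perm_inj.
- rewrite -ar (reindex_inj (@perm_inj _ p)).
  by apply: eq_bigr => i _; rewrite relabel_expE.
- by rewrite supp_relabel -sf imsetU imset_set1.
Qed.

End Exponents.

Section Anchoring.
Variables (D r : nat).
Implicit Types (f : {set 'I_D.+1}) (k : 'I_D.+1) (a : {ffun 'I_D.+1 -> nat}).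

Lemma calS_supp f k a i : calS r (f, k, a) ->
  (i \in f) = (0 < a i)%N || (i == k).
Proof. by case=> _ _ _ <-; rewrite !inE. Qed.

(** A label [i] of the support below the minimum of [f :\ k] cannot lie in [f :\ k], so it is [k]
    itself; this forces both [0 < a k] and [k = face_min f]. *)
Lemma calS_calB f k a : calS r (f, k, a) ->
  a k = 0%N \/ k <> face_min f -> calB r (f, k, a).
Proof.
move=> S h; split=> // i ilt; rewrite ffunE; apply/negP => ai.
have fi : i \in f by rewrite (calS_supp _ S) ai.
have [ik|ik] := eqVneq i k; last first.
  have := @face_min_le _ (f :\ k) i; rewrite !inE ik fi => /(_ isT).
  by rewrite leqNgt ilt.
case: h => [a0|]; first by rewrite ik a0 in ai.
apply; have fm := face_min_mem fi.
(* Otherwise [face_min f] lies in [f :\ k], and [face_min (f :\ k) <= face_min f <= i] contradicts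
   the choice of [i]. *)
apply/eqP/negPn/negP; rewrite eq_sym => mk.
have := @face_min_le _ (f :\ k) (face_min f); rewrite !inE mk fm => /(_ isT) le.
by have := face_min_le fi; rewrite leqNgt (leq_trans _ le).
Qed.

(** Since [0 < a k], the support is all of [f], so any label of [f] may take the place of [k]; a
    label other than the smallest one then meets the criterion of [calS_calB]. *)
Lemma calS_calB_other f k a u : calS r (f, k, a) -> (0 < a k)%N ->
  k = face_min f -> u \in f :\ k -> calB r (f, u, a).
Proof.
move=> S ak km; rewrite !inE => /andP[uk uf]; have [fD kf ar sf] := S.
have fa i : (i \in f) = (0 < a i)%N.
  by rewrite (calS_supp _ S); case: eqP => [->|_]; rewrite ?ak ?orbF.
apply: calS_calB.
  split=> //; apply/setP => i; rewrite !inE fa.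
  by case: eqP => [->|]; rewrite ?orbF // -fa uf.
by right => um; rewrite -km in um; rewrite um eqxx in uk.
Qed.

End Anchoring.

(** * Pullback of forms under relabelling *)

Lemma dformE (R : realType) (D : nat) (g : 'rV[R]_D -> R^o) x u :
  dform g x u = 'd g x u.
Proof. exact: lfunE. Qed.

Lemma pullback_formE (R : realType) (D : nat) (A : 'rV[R]_D -> 'rV[R]_D)
    (om : form1 R D) x u :
  pullback A om x u = om (A x) ('d A x u).
Proof. by rewrite /pullback comp_lfunE; congr (om _ _); exact: lfunE. Qed.

(** The shape of [psi] with abstract covectors: precomposition with [h] is linear, and injectivity
    of [p] turns the sum over [f] into one over [p @: f]. *)
Lemma comp_lfun_imset (F : fieldType) (U V W : vectType F) (I : finType)
    (p : {perm I}) (M : I -> 'Hom(V, W)) (N : I -> 'Hom(U, W)) (h : 'Hom(U, V))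
    (f : {set I}) (k : I) (c : F) :
  (forall i, (M i \o h)%VF = N (p i)) ->
  ((M k - c *: \sum_(j in f) M j) \o h)%VF =
  N (p k) - c *: \sum_(j in p @: f) N j.
Proof.
move=> MN; rewrite comp_lfunDl comp_lfunNl -comp_lfunZl MN.
rewrite (big_morph (fun g => g \o h)%VF
  (fun g1 g2 => comp_lfunDl g1 g2 h) (comp_lfun0l _ h)).
rewrite big_imset /=; last by move=> i j _ _; exact: perm_inj.
by congr (_ - _ *: _); apply: eq_bigr => i _; exact: MN.
Qed.

Section Pullback.
Variables (R : realType) (D : nat) (v : 'I_D.+1 -> 'rV[R]_D).
Hypothesis v_nondegenerate : nondegenerate_simplex v.
Variables (xi lam : 'I_D.+1 -> 'rV[R]_D -> R^o) (p : 'S_D.+1).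
Hypotheses (xiP : barycentric v xi) (lamP : barycentric v lam).
Variable A : 'rV[R]_D -> 'rV[R]_D.
Hypothesis AP : relabelling_map v (p^-1)%g A.
Implicit Types (f : {set 'I_D.+1}) (k : 'I_D.+1) (x : 'rV[R]_D).
Implicit Types (a : {ffun 'I_D.+1 -> nat}) (s : {ffun 'I_D.+1 -> bool}).

Lemma barycentric_relabelling i : xi i \o A = lam (p i).
Proof.
have [xiA xiv] := xiP i; have [lamA lamv] := lamP (p i); have [AA Av] := AP.
apply: (affine_map_eq_simplex v_nondegenerate) => //.
  exact: affine_map_comp.
(* [A] sends [v j] to the vertex labelled [p^-1 j], and [i = p^-1 j] iff [p i = j]. *)
move=> j; rewrite /= Av xiv lamv.
by rewrite -(inj_eq (@perm_inj _ p)) permKV.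
Qed.

Lemma pullback_dform i x : pullback A (dform (xi i)) x = dform (lam (p i)) x.
Proof.
have dAx : differentiable A x by apply: affine_map_differentiable; case: AP.
have dxi : differentiable (xi i) (A x).
  by apply: affine_map_differentiable; case: (xiP i).
apply/lfunP => u; rewrite pullback_formE.
apply: etrans (dformE _ _ _) _; apply: etrans (esym (dformE _ _ _)).
rewrite -barycentric_relabelling.
exact (esym (congr1 (fun h => h u) (diff_comp dAx dxi))).
Qed.

Lemma bmono_relabelling a x : bmono xi a (A x) = bmono lam (relabel_exp p a) x.
Proof.
rewrite /bmono [RHS](reindex_inj (@perm_inj _ p)); apply: eq_bigr => i _.
by rewrite relabel_expE -barycentric_relabelling.
Qed.

Lemma pullback_psi f k a x : pullback A (psi xi f k (support_ind a)) x =
  psi lam (p @: f) (p k) (support_ind (relabel_exp p a)) x.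
Proof.
rewrite /psi; set c := (_ / _); set c' := (_ / _).
(* Relabelling preserves both the entry of the indicator at the marked label and its total. *)
have <- : c = c'.
  congr (_%:R / _%:R); first by rewrite !ffunE permK.
  rewrite [RHS](reindex_inj (@perm_inj _ p)).
  by apply: eq_bigr => i _; rewrite !ffunE permK.
exact: (comp_lfun_imset _ _ _ (fun i => pullback_dform i x)).
Qed.

Lemma pullback_wform f k a x : pullback A (wform xi f k a) x =
  bmono lam (relabel_exp p a) x *: pullback A (psi xi f k (support_ind a)) x.
Proof. by rewrite /pullback /wform -comp_lfunZl bmono_relabelling. Qed.

End Pullback.

(** As [s] is the indicator of [f], the coefficients [s u / |s|] over [u] in [f] add up to 1, so in
    the sum of all [psi lam f u s] the two sums of differentials cancel. *)
Lemma psi_filter (R : realType) (D : nat) (lam : 'I_D.+1 -> 'rV[R]_D -> R^o)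
    (f : {set 'I_D.+1}) (k : 'I_D.+1) (s : {ffun 'I_D.+1 -> bool}) x :
  k \in f -> (forall i, s i = (i \in f)) ->
  psi lam f k s x = - \sum_(u in f :\ k) psi lam f u s x.
Proof.
move=> kf sf; apply/eqP; rewrite -addr_eq0 -big_setD1 //= /psi.
have -> : (\sum_i s i)%N = #|f|.
  by rewrite -sum1_card [RHS]big_mkcond; apply: eq_bigr => i _; rewrite sf; case: ifP.
rewrite sumrB -scaler_suml -mulr_suml.
have -> : \sum_(i in f) (s i)%:R = #|f|%:R :> R.
  by rewrite -sum1_card natr_sum; apply: eq_bigr => i fi; rewrite sf fi.
rewrite divff ?scale1r ?subrr // pnatr_eq0 -lt0n.
by apply/card_gt0P; exists k.
Qed.

Theorem theorem6 (R : realType) (D r : nat) (hD : (1 <= D)%N) (hr : (1 <= r)%N)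
  (v : 'I_D.+1 -> 'rV[R]_D) (hv : nondegenerate_simplex v)
  (xi lam : 'I_D.+1 -> 'rV[R]_D -> R^o)
  (hxi : barycentric v xi) (hlam : barycentric v lam)
  (A : 'S_D.+1 -> 'rV[R]_D -> 'rV[R]_D)
  (hA : forall p : 'S_D.+1, relabelling_map v p (A p))
  (f : {set 'I_D.+1}) (k : 'I_D.+1) (a : {ffun 'I_D.+1 -> nat})
  (hB : calB r (f, k, a)) (p : 'S_D.+1) :
  let q := (p^-1)%g in
  let relabelled := a k = 0%N \/ p k <> face_min (p @: f) in
  let filter_hit := (0 < a k)%N /\ p k = face_min (p @: f) in
  [/\ (forall x, simplex v x ->
         pullback (A q) (wform xi f k a) x =
         bmono lam (relabel_exp p a) x
           *: pullback (A q) (psi xi f k (support_ind a)) x),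
      (relabelled /\ ~ filter_hit) \/ (filter_hit /\ ~ relabelled),
      (relabelled ->
         (forall x, simplex v x ->
            pullback (A q) (wform xi f k a) x =
            wform lam (p @: f) (p k) (relabel_exp p a) x) /\
         calB r (p @: f, p k, relabel_exp p a))
    & (filter_hit ->
         (forall x, simplex v x ->
            pullback (A q) (wform xi f k a) x =
            - \sum_(u in (p @: f) :\ p k)
                wform lam (p @: f) u (relabel_exp p a) x) /\
         (forall u, u \in (p @: f) :\ p k ->
            calB r (p @: f, u, relabel_exp p a)))].
Proof.
move=> q; have [S _] := hB; have Sp := calS_relabel p S.
have wE x := pullback_wform hv hxi hlam (hA q) f k a x.
have psiE x := pullback_psi hv hxi hlam (hA q) f k a x.
split.
- by move=> x _; exact: wE.
- have [a0|a0] := posnP (a k); first by left; split; [left | case].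
  have [pk|/eqP pk] := eqVneq (p k) (face_min (p @: f)).
    by right; split=> // -[/eqP|//]; rewrite -leqn0 leqNgt a0.
  by left; split; [right | case].
- move=> h; split=> [x _|]; first by rewrite wE psiE.
  by apply: calS_calB => //; rewrite relabel_expE.
move=> [ak pk]; have ap : (0 < relabel_exp p a (p k))%N by rewrite relabel_expE.
split=> [x _|u uf]; last exact: calS_calB_other Sp ap pk uf.
(* All the forms of the face carry the same monomial, so the relation between the [psi] is simply
   scaled by it. *)
rewrite wE psiE psi_filter ?scalerN ?scaler_sumr //; first by case: Sp.
(* Here [p k] is in the support of the relabelled exponent, so the support indicator is that of the
   whole face. *)
move=> i; rewrite (calS_supp _ Sp) [LHS]ffunE.
by case: eqP => [->|_]; rewrite ?ap ?orbF.
Qed.
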